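(* Let $Q\ge 1$, let $\mathbf{o}_1,\dots,\mathbf{o}_Q\in\mathbb{R}^2$, $\mathbf{x}\in\mathbb{R}^2$, $\mathbf{v}\in\mathbb{R}^2\setminus\{0\}$, let $\alpha_1,\dots,\alpha_Q\in\mathbb{R}\setminus\{0\}$ and $\sigma_1,\dots,\sigma_Q>0$. Put $\boldsymbol{l}_q=\mathbf{x}-\mathbf{o}_q$ and $d_{t,q}=\|\boldsymbol{l}_q+t\mathbf{v}\|_2$, and assume $\min_{t\ge 1} d_{t,q}>0$ for every $q$. Let $\alpha_{\max}^2=\max_q\alpha_q^2$, $\sigma_{\min}^2=\min_q\sigma_q^2$. For integers $T\ge 1$ let $$\mathbf{F}_{T,x}=\sum_{t=1}^{T}\sum_{q=1}^{Q}\frac{\alpha_q^2}{\sigma_q^2 d_{t,q}^4}(\boldsymbol{l}_q+t\mathbf{v})(\boldsymbol{l}_q+t\mathbf{v})^{\mathrm T},\qquad B(\mathbf{x})=\mathrm{tr}\{\mathbf{F}_{T,x}^{-1}\},$$ $$\bar{\Delta}_{T,x}=\mathrm{tr}\Big\{\Big(\frac{\alpha_{\max}^2}{\sigma_{\min}^2}\sum_{t=1}^{T}\sum_{q=1}^{Q}\frac{1}{d_{t,q}^4}(\boldsymbol{l}_q+t\mathbf{v})(\boldsymbol{l}_q+t\mathbf{v})^{\mathrm T}\Big)^{-1}\Big\}.$$ Then $B(\mathbf{x})\ge\bar{\Delta}_{T,x}$ for every $T$, with equality when $\sigma_q^2=\sigma_{\min}^2$ and $\alpha_q^2=\alpha_{\max}^2$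 for all $q$. In addition, if at least two vectors in $\{\boldsymbol{l}_1,\dots,\boldsymbol{l}_Q,\mathbf{v}\}$ are linearly independent, then $\bar{\Delta}_{T,x}$ is strictly decreasing in $T$, but $\bar{\Delta}_{T,x}$ converges to a strictly positive number as $T\to\infty$.
   Context: Setting: a mobile user moves along $\mathbf{x}_t=\mathbf{x}+t\mathbf{v}$, $t=1,2,\dots$, and base station $q$ at $\mathbf{o}_q$ observes $y_{t,q}=\beta_q+\alpha_q\log d_{t,q}+\xi_{q,t}$ with independent Gaussian noise $\xi_{q,t}\sim\mathcal{N}(0,\sigma_q^2)$. $\mathbf{F}_{T,x}$ is the Fisher information matrix of the initial position $\mathbf{x}$ from the measurements at $t=1,\dots,T$ and $B(\mathbf{x})$ is the corresponding Cramér–Rao lower bound. Convention: for a singular positive semidefinite matrix $\mathbf{M}$, $\mathrm{tr}\{\mathbf{M}^{-1}\}=+\infty$. *)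

(* Defs.v *)
From HB Require Import structures.
From mathcomp Require Export all_boot all_order all_algebra.
From mathcomp Require Export all_classical all_reals all_analysis.

Set Implicit Arguments.
Unset Strict Implicit.
Unset Printing Implicit Defensive.

Export Order.TTheory GRing.Theory Num.Theory.
Export numFieldNormedType.Exports.

Local Open Scope classical_set_scope.
Local Open Scope ring_scope.

(* The canonical norm `|u| on matrices is the sup norm, hence this definition. *)
Definition norm2 (R : realType) (n : nat) (u : 'cV[R]_n) : R :=
  Num.sqrt (\sum_(i < n) u i 0 ^+ 2).

(* tr (M^-1), with the convention that it is +oo when M is singular; meant for
   positive semidefinite M. *)
Definition trinv (R : realType) (n : nat) (M : 'M[R]_n) : \bar R :=
  if M \in unitmx then (\tr (invmx M))%:E else +oo%E.

(* The value at index 0 is only used as a neutral element. *)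
Definition maxq (R : realType) (Q : nat) (hQ : (0 < Q)%N) (f : 'I_Q -> R) : R :=
  \big[Num.max/f (Ordinal hQ)]_(q < Q) f q.

Definition minq (R : realType) (Q : nat) (hQ : (0 < Q)%N) (f : 'I_Q -> R) : R :=
  \big[Num.min/f (Ordinal hQ)]_(q < Q) f q.

Section Localization.
Variables (R : realType) (Q : nat).
Variables (o : 'I_Q -> 'cV[R]_2) (x v : 'cV[R]_2) (alpha sigma : 'I_Q -> R).

Definition lvec (q : 'I_Q) : 'cV[R]_2 := x - o q.

Definition relpos (t : nat) (q : 'I_Q) : 'cV[R]_2 := lvec q + t%:R *: v.

Definition dist (t : nat) (q : 'I_Q) : R := norm2 (relpos t q).

Definition fisher (T : nat) : 'M[R]_2 :=
  \sum_(1 <= t < T.+1) \sum_(q < Q)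
    (alpha q ^+ 2 / (sigma q ^+ 2 * dist t q ^+ 4)) *:
      (relpos t q *m (relpos t q)^T).

Definition crlb (T : nat) : \bar R := trinv (fisher T).

Definition alpha_max2 (hQ : (0 < Q)%N) : R := maxq hQ (fun q => alpha q ^+ 2).

Definition sigma_min2 (hQ : (0 < Q)%N) : R := minq hQ (fun q => sigma q ^+ 2).

Definition Delta_bar (hQ : (0 < Q)%N) (T : nat) : \bar R :=
  trinv ((alpha_max2 hQ / sigma_min2 hQ) *:
    \sum_(1 <= t < T.+1) \sum_(q < Q)
      (1 / dist t q ^+ 4) *: (relpos t q *m (relpos t q)^T)).

End Localization.

(* Main.v *)
(** For 2x2 matrices [\tr A^-1 = \tr A / \det A], and adding a positive
    semidefinite [P] to a positive definite [A] makes the numerator of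
    [\tr A^-1 - \tr (A + P)^-1] equal to [\tr A * \det P] plus two values of
    the quadratic form of [P]; hence the trace of the inverse is antitone,
    strictly so when a nonzero rank-one term is added.  The information matrix
    grows with [T] and is regular from [T = 2] on, as its kernel would be
    orthogonal to [v] and to every [l_q].  Its trace is [k * \sum_t \sum_q d_{t,q}^-2], which is
    bounded because [d_{t,q}] grows linearly in [t]; as [\tr A^-1 >= 1 / \tr A],
    the decreasing sequence stays away from 0. *)
Require Import Defs.
From mathcomp Require Import ring lra.

Set Implicit Arguments.
Unset Strict Implicit.
Unset Printing Implicit Defensive.

Local Open Scope classical_set_scope.
Local Open Scope ring_scope.

(** * Quadratic forms and positive semidefinite matrices *)

Section QuadraticForm.
Variables (R : realType) (n : nat).
Implicit Types (M P : 'M[R]_n) (u z : 'cV[R]_n).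

Definition qform M z : R := (z^T *m M *m z) 0 0.

(** Symmetry is required separately: over the reals a nonnegative form does not force it, and the
    determinant formulas below rely on it. *)
Definition psd M : Prop := M^T = M /\ forall z, 0 <= qform M z.

Lemma qformD M P z : qform (M + P) z = qform M z + qform P z.
Proof. by rewrite /qform mulmxDr mulmxDl mxE. Qed.

Lemma qformZ a M z : qform (a *: M) z = a * qform M z.
Proof. by rewrite /qform -scalemxAr -scalemxAl mxE. Qed.

Lemma qform_sum I (r : seq I) (p : pred I) (F : I -> 'M[R]_n) z :
  qform (\sum_(i <- r | p i) F i) z = \sum_(i <- r | p i) qform (F i) z.
Proof.
apply: (big_morph (fun M => qform M z)) => [M P|]; first exact: qformD.
by rewrite /qform mulmx0 mul0mx mxE.
Qed.

Lemma qform_rank1 u z : qform (u *m u^T) z = (z^T *m u) 0 0 ^+ 2.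
Proof.
rewrite /qform mulmxA -mulmxA mxE big_ord1 expr2; congr (_ * _).
by rewrite -[in LHS](trmxK z) -trmx_mul mxE.
Qed.

Lemma psdD M P : psd M -> psd P -> psd (M + P).
Proof.
move=> [sM hM] [sP hP]; split=> [|z]; first by rewrite linearD /= sM sP.
by rewrite qformD addr_ge0.
Qed.

Lemma psdZ a M : 0 <= a -> psd M -> psd (a *: M).
Proof.
move=> a0 [sM hM]; split=> [|z]; first by rewrite linearZ /= sM.
by rewrite qformZ mulr_ge0.
Qed.

Lemma psd0 : psd (0 : 'M[R]_n).
Proof. by split=> [|z]; rewrite ?trmx0// /qform mulmx0 mul0mx mxE. Qed.

Lemma psd_sum I (r : seq I) (p : pred I) (F : I -> 'M[R]_n) :
  (forall i, p i -> psd (F i)) -> psd (\sum_(i <- r | p i) F i).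
Proof. by move=> hF; apply: big_ind => //; [exact: psd0 | exact: psdD]. Qed.

Lemma psd_rank1 u : psd (u *m u^T).
Proof.
split=> [|z]; first by rewrite trmx_mul trmxK.
by rewrite qform_rank1 sqr_ge0.
Qed.

End QuadraticForm.

(** * Determinant, trace and trace of the inverse in dimension 2 *)

Section Dimension2.
Variable R : realType.
Implicit Types (A P : 'M[R]_2) (u w z : 'cV[R]_2).

Lemma lift01 : lift 0 0 = 1 :> 'I_2. Proof. exact/val_inj. Qed.

Lemma lift10 : lift 1 0 = 0 :> 'I_2. Proof. exact/val_inj. Qed.

Lemma eq_cV2 u w : u 0 0 = w 0 0 -> u 1 0 = w 1 0 -> u = w.
Proof.
move=> h0 h1; apply/matrixP => i j; rewrite ord1.
by case: (unliftP 0 i) => [k|] ->; rewrite ?ord1 // lift01.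
Qed.

Definition vec2 (a b : R) : 'cV[R]_2 := \col_i (if i == 0 then a else b).

Lemma dot2 z u : (z^T *m u) 0 0 = z 0 0 * u 0 0 + z 1 0 * u 1 0.
Proof. by rewrite mxE big_ord_recl big_ord1 !mxE lift01. Qed.

Lemma qform2 A a b : A^T = A ->
  qform A (vec2 a b) = A 0 0 * a ^+ 2 + 2 * A 0 1 * a * b + A 1 1 * b ^+ 2.
Proof.
move=> sA; have s01 : A 1 0 = A 0 1 by rewrite -[in LHS]sA mxE.
rewrite /qform mxE big_ord_recl big_ord1 !mxE !big_ord_recl !big_ord0 !mxE /=.
by rewrite lift01 s01; ring.
Qed.

Lemma det2_sym A : A^T = A -> \det A = A 0 0 * A 1 1 - A 0 1 ^+ 2.
Proof.
move=> sA; have s01 : A 1 0 = A 0 1 by rewrite -[in LHS]sA mxE.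
rewrite (expand_det_row _ 0) big_ord_recl big_ord1 lift01 /cofactor !det_mx11.
by rewrite !mxE !lift01 ?lift10 s01 /=; ring.
Qed.

Lemma trace2 A : \tr A = A 0 0 + A 1 1.
Proof. by rewrite /mxtrace big_ord_recl big_ord1 lift01. Qed.

Lemma trinvE A :
  trinv A = if \det A == 0 then +oo%E else (\tr A / \det A)%:E.
Proof.
rewrite /trinv unitmxE unitfE; case: eqP => //= /eqP dA.
rewrite /invmx unitmxE unitfE dA mxtraceZ mulrC; congr ((_ / _)%:E).
rewrite !trace2 !mxE /cofactor !det_mx11 !mxE lift01 lift10 /= addrC.
by rewrite expr0 sqrrN expr1n !mul1r.
Qed.

Lemma psd2P A : psd A ->
  [/\ 0 <= A 0 0, 0 <= A 1 1 & 0 <= A 0 0 * A 1 1 - A 0 1 ^+ 2].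
Proof.
move=> [sA hA].
have q a b : 0 <= A 0 0 * a ^+ 2 + 2 * A 0 1 * a * b + A 1 1 * b ^+ 2.
  by rewrite -qform2.
have a0 : 0 <= A 0 0 by have := q 1 0; nra.
have c0 : 0 <= A 1 1 by have := q 0 1; nra.
split=> //.
have [a_eq0|an0] := eqVneq (A 0 0) 0.
  (* With [A 0 0 = 0] the form at this vector is [- (A 1 1 + 2) * A 0 1 ^+ 2], which forces
     [A 0 1 = 0]. *)
  have := q (- (A 1 1 + 1)) (A 0 1); rewrite a_eq0 => h.
  have : 0 <= - ((A 1 1 + 2) * A 0 1 ^+ 2) by nra.
  have := sqr_ge0 (A 0 1); nra.
have agt0 : 0 < A 0 0 by rewrite lt0r an0.
(* The form at [(A 0 1, - A 0 0)] equals [A 0 0] times the determinant. *)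
rewrite -(pmulr_rge0 _ agt0); have := q (A 0 1) (- A 0 0); nra.
Qed.

Lemma psd_det_ge0 A : psd A -> 0 <= \det A.
Proof. by move=> pA; have [_ _] := psd2P pA; rewrite det2_sym; case: pA. Qed.

Lemma psd_det_eq0 A : psd A -> \det A = 0 ->
  exists2 z, z != 0 & qform A z = 0.
Proof.
move=> [sA hA]; rewrite det2_sym // => d0.
have [a_eq0|an0] := eqVneq (A 0 0) 0.
  exists (vec2 1 0); last by rewrite qform2 // a_eq0; ring.
  by apply/eqP => /matrixP/(_ 0 0); rewrite !mxE /= => /eqP; rewrite oner_eq0.
exists (vec2 (A 0 1) (- A 0 0)).
  apply: contra an0 => /eqP/matrixP/(_ 1 0); rewrite !mxE /= => /eqP.
  by rewrite oppr_eq0.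
rewrite qform2 //; transitivity (A 0 0 * (A 0 0 * A 1 1 - A 0 1 ^+ 2)).
  by ring.
by rewrite d0 mulr0.
Qed.

Lemma psd_det_gt0 A : psd A -> \det A != 0 ->
  [/\ 0 < A 0 0, 0 < A 1 1 & 0 < \det A].
Proof.
move=> pA dn0; have [a0 c0 _] := psd2P pA.
have d0 : 0 < \det A by rewrite lt0r dn0 psd_det_ge0.
have sA := pA.1; have := d0; rewrite det2_sym // => d0'.
by split=> //; rewrite lt0r ?a0 ?c0 andbT; apply/eqP => e; move: d0';
  rewrite e ?mul0r ?mulr0 sub0r oppr_gt0 ltNge sqr_ge0.
Qed.

(** For regular [A], [A 0 0 * (\det (A + P) - \det A)] is the form of [P] at [(A 0 1, - A 0 0)] plus
    [P 0 0 * \det A + A 0 0 * \det P], all nonnegative. *)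
Lemma det_addr_psd A P : psd A -> psd P -> \det A <= \det (A + P).
Proof.
move=> pA pP; have pAP := psdD pA pP.
have [dA0|dAn0] := eqVneq (\det A) 0; first by rewrite dA0 psd_det_ge0.
have [a0 c0 dA] := psd_det_gt0 pA dAn0.
have [p0 r0 dP] := psd2P pP.
move: dA; rewrite !det2_sym ?pA.1 ?pP.1 ?pAP.1 // !mxE => dA.
have := pP.2 (vec2 (A 0 1) (- A 0 0)); rewrite qform2 ?pP.1 // => h.
rewrite -(ler_pM2l a0); nra.
Qed.

(** Up to sign the two vectors are the columns of [\adj A], so the two form values add up to the
    trace of [\adj A *m P *m \adj A]; Cayley-Hamilton for [\adj A] then explains the identity. *)
Lemma trace_det_addr A P : A^T = A -> P^T = P ->
  \tr A * \det (A + P) - \tr (A + P) * \det A =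
  \tr A * \det P + qform P (vec2 (A 0 1) (- A 0 0))
  + qform P (vec2 (A 1 1) (- A 0 1)).
Proof.
move=> sA sP; have sAP : (A + P)^T = A + P by rewrite linearD /= sA sP.
rewrite !trace2 !det2_sym // !qform2 // !mxE; ring.
Qed.

Lemma trinv_addr_psd A P : psd A -> psd P -> (trinv (A + P) <= trinv A)%E.
Proof.
move=> pA pP; rewrite !trinvE.
have [dA0|dAn0] := eqVneq (\det A) 0; first by rewrite leey.
have [a0 c0 dA] := psd_det_gt0 pA dAn0.
have dAP := lt_le_trans dA (det_addr_psd pA pP).
rewrite gt_eqF // lee_fin ler_pdivrMr // mulrAC ler_pdivlMr // -subr_ge0.
rewrite trace_det_addr ?pA.1 ?pP.1 //.
by rewrite !addr_ge0 ?mulr_ge0 ?psd_det_ge0 ?pP.2 // trace2 addr_ge0 ?ltW.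
Qed.

Lemma trinv_addr_rank1 A u c : psd A -> \det A != 0 -> u != 0 -> 0 < c ->
  (trinv (A + c *: (u *m u^T)) < trinv A)%E.
Proof.
move=> pA dAn0 un0 c0; set P := c *: _.
have pP : psd P by apply: psdZ; [exact: ltW | exact: psd_rank1].
have [a0 b0 dA] := psd_det_gt0 pA dAn0.
have dAP := lt_le_trans dA (det_addr_psd pA pP).
rewrite !trinvE (negPf dAn0) gt_eqF // lte_fin.
rewrite ltr_pdivrMr // mulrAC ltr_pdivlMr // -subr_gt0.
rewrite trace_det_addr ?pA.1 ?pP.1 // -addrA ltr_wpDl //.
  by rewrite mulr_ge0 ?psd_det_ge0 // trace2 addr_ge0 ?ltW.
rewrite !qformZ !qform_rank1 !dot2 !mxE /= -mulrDr mulr_gt0 //.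
rewrite lt0r addr_ge0 ?sqr_ge0 // andbT.
rewrite paddr_eq0 ?sqr_ge0 // !sqrf_eq0; apply: contra un0.
move=> /andP[/eqP e1 /eqP e2].
move: dA; rewrite det2_sym ?pA.1 // => dA.
(* [e1] and [e2] say that [\adj A *m u = 0]. Multiplying by [A] gives [\det A *: u = 0]; the
   coefficients used below are the rows of [A *m \adj A = (\det A)%:M], up to sign and order. *)
have comb0 (a b y z : R) : y = 0 -> z = 0 -> a * y + b * z = 0.
  by move=> -> ->; rewrite !mulr0 addr0.
apply/eqP/eq_cV2; rewrite !mxE; apply: (mulfI (lt0r_neq0 dA)); rewrite mulr0.
  by rewrite -(comb0 (- A 0 1) (A 0 0) _ _ e1 e2); ring.
by rewrite -(comb0 (- A 1 1) (A 0 1) _ _ e1 e2); ring.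
Qed.

(** Here [\det A <= A 0 0 * A 1 1 <= (\tr A) ^+ 2], hence [\tr A / \det A >= 1 / \tr A] when [A] is
    regular. *)
Lemma trinv_ge A (C : R) : psd A -> 0 < C -> \tr A <= C ->
  (C^-1%:E <= trinv A)%E.
Proof.
move=> pA C0 trC; rewrite trinvE.
have [dA0|dAn0] := eqVneq (\det A) 0; first by rewrite leey.
have [a0 c0 dA] := psd_det_gt0 pA dAn0.
rewrite lee_fin ler_pdivlMr // ler_pdivrMl //.
have tr0 : 0 < \tr A by rewrite trace2 addr_gt0.
apply: (@le_trans _ _ (\tr A * \tr A)); last by rewrite ler_pM2r.
have := sqr_ge0 (A 0 1); rewrite trace2 det2_sym ?pA.1 //; nra.
Qed.

(** In the plane the orthogonal complement of a nonzero [z] is the line spanned by [zp], the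
    rotation of [z] by a right angle, and both vectors lie on it. *)
Lemma not_free_orthogonal z u w : z != 0 ->
  (z^T *m u) 0 0 = 0 -> (z^T *m w) 0 0 = 0 -> ~~ free [:: u; w].
Proof.
move=> zn0; rewrite !dot2 => zu zw; rewrite free_cons seq1_free span_seq1.
rewrite negb_and !negbK; have [//|wn0] := eqVneq w 0; first by rewrite orbT.
rewrite orbF; set s := z 0 0 ^+ 2 + z 1 0 ^+ 2.
have sn0 : s != 0.
  apply: contra zn0; rewrite paddr_eq0 ?sqr_ge0 // !sqrf_eq0.
  by move=> /andP[/eqP e0 /eqP e1]; apply/eqP/eq_cV2; rewrite !mxE.
pose zp := vec2 (- z 1 0) (z 0 0).
have para (y : 'cV[R]_2) : z 0 0 * y 0 0 + z 1 0 * y 1 0 = 0 ->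
    exists c, y = c *: zp.
  move=> zy; exists ((z 0 0 * y 1 0 - z 1 0 * y 0 0) / s).
  apply: eq_cV2; rewrite !mxE /=; apply: (mulIf sn0); rewrite mulrAC divfK //.
    by apply/eqP; rewrite -subr_eq0 -(mulr0 (z 0 0)) -zy; apply/eqP; rewrite /s; ring.
  by apply/eqP; rewrite -subr_eq0 -(mulr0 (z 1 0)) -zy; apply/eqP; rewrite /s; ring.
have [a ->] := para _ zu; have [b wE] := para _ zw; rewrite wE.
have bn0 : b != 0 by apply: contra wn0 => /eqP b0; rewrite wE b0 scale0r.
by apply/vlineP; exists (a / b); rewrite scalerA divfK.
Qed.

End Dimension2.

(** * A uniform bound for the sums of inverse squares *)

Lemma sum_inv_sqr_le (R : realType) (T : nat) :
  \sum_(1 <= t < T.+1) (t%:R ^+ 2)^-1 <= 2 :> R.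
Proof.
(* Since [t + 1 <= 2 * t], [1 / t ^+ 2 <= 2 / (t * (t + 1))], which is [f t.+1 - f t]; the sum
   telescopes to at most [- f 1 = 2]. *)
pose f t : R := - (2 / t%:R).
apply: (@le_trans _ _ (\sum_(1 <= t < T.+1) (f t.+1 - f t))).
  apply: ler_sum_nat => t /andP[t1 _].
  have t0 : 1 <= t%:R :> R by rewrite ler1n.
  rewrite /f -[t.+1%:R]natr1; move: t0; set s : R := t%:R => t0.
  have -> : - (2 / (s + 1)) - - (2 / s) = 2 / (s * (s + 1)) by field; lra.
  rewrite -[leLHS]div1r ler_pdivrMr ?exprn_gt0 ?(lt_le_trans _ t0) //.
  rewrite mulrAC ler_pdivlMr; nra.
rewrite telescope_sumr // /f invr1 mulr1 opprK.
by rewrite gerDr oppr_le0 divr_ge0.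
Qed.

(** * Weighted Gram matrices of the relative positions: monotonicity and regularity *)

Section RelativePositions.
Variables (R : realType) (Q : nat).
Variables (o : 'I_Q -> 'cV[R]_2) (x v : 'cV[R]_2).
Let r := relpos o x v.
Let d := dist o x v.
Let l := lvec o x.

(** Both information matrices are instances, so comparing them reduces to comparing their
    weights. *)
Definition wgram (w : nat -> 'I_Q -> R) (T : nat) : 'M[R]_2 :=
  \sum_(1 <= t < T.+1) \sum_(q < Q) w t q *: (r t q *m (r t q)^T).

Lemma norm2_sqr (u : 'cV[R]_2) : norm2 u ^+ 2 = u 0 0 ^+ 2 + u 1 0 ^+ 2.
Proof.
rewrite sqr_sqrtr ?sumr_ge0 // => [|i _]; last exact: sqr_ge0.
by rewrite big_ord_recl big_ord1 lift01.
Qed.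

Lemma psd_wgram w T : (forall t q, 0 <= w t q) -> psd (wgram w T).
Proof.
by move=> w0; apply: psd_sum => t _; apply: psd_sum => q _;
  apply: psdZ => //; exact: psd_rank1.
Qed.

Lemma wgramD w1 w2 T :
  wgram (fun t q => w1 t q + w2 t q) T = wgram w1 T + wgram w2 T.
Proof.
rewrite -big_split; apply: eq_bigr => t _; rewrite -big_split.
by apply: eq_bigr => q _; rewrite scalerDl.
Qed.

Lemma wgramZ a w T : wgram (fun t q => a * w t q) T = a *: wgram w T.
Proof.
rewrite scaler_sumr; apply: eq_bigr => t _; rewrite scaler_sumr.
by apply: eq_bigr => q _; rewrite scalerA.
Qed.

Lemma wgramS w T :
  wgram w T.+1 =
  wgram w T + \sum_(q < Q) w T.+1 q *: (r T.+1 q *m (r T.+1 q)^T).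
Proof. by rewrite /wgram big_nat_recr. Qed.

Lemma wgram0 w : wgram w 0 = 0.
Proof. by rewrite /wgram big_geq. Qed.

Lemma trinv_wgram_anti w T T' : (forall t q, 0 <= w t q) -> (T <= T')%N ->
  (trinv (wgram w T') <= trinv (wgram w T))%E.
Proof.
move=> w0; elim: T' => [|T' IH]; first by rewrite leqn0 => /eqP->.
rewrite leq_eqVlt => /orP[/eqP->//|/IH]; apply: le_trans.
rewrite wgramS; apply: trinv_addr_psd; first exact: psd_wgram.
by apply: psd_sum => q _; apply: psdZ => //; exact: psd_rank1.
Qed.

Lemma trinv_wgram_lt w T (q0 : 'I_Q) : (forall t q, 0 <= w t q) ->
  0 < w T.+1 q0 -> r T.+1 q0 != 0 -> \det (wgram w T) != 0 ->
  (trinv (wgram w T.+1) < trinv (wgram w T))%E.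
Proof.
move=> w0 wq rq dn0; rewrite wgramS (bigD1 q0) //= addrA.
have pW := psd_wgram T w0.
(* The single term of [q0] at time [T.+1] makes the decrease strict; the other stations can only
   lower the value further. *)
apply: le_lt_trans (trinv_addr_rank1 pW dn0 rq wq).
apply: trinv_addr_psd.
  by apply: psdD => //; apply: psdZ => //; exact: psd_rank1.
by apply: psd_sum => q _; apply: psdZ => //; exact: psd_rank1.
Qed.

Lemma wgram_det_neq0 w T : (forall t q, (0 < t)%N -> 0 < w t q) ->
  (forall t q, 0 <= w t q) ->
  (exists u u' : 'cV[R]_2,
     [/\ u \in v :: [seq l q | q : 'I_Q],
         u' \in v :: [seq l q | q : 'I_Q] & free [:: u; u']]) ->
  (0 < Q)%N -> (1 < T)%N -> \det (wgram w T) != 0.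
Proof.
move=> wgt w0 [u [u' [hu hu' uf]]] hQ T1; apply/eqP => dW.
have [z zn0] := psd_det_eq0 (psd_wgram T w0) dW.
have q0 t q : 0 <= qform (w t q *: (r t q *m (r t q)^T)) z.
  by rewrite qformZ qform_rank1 mulr_ge0 // sqr_ge0.
rewrite qform_sum => /eqP; rewrite psumr_eq0; last first.
  by move=> t _; rewrite qform_sum sumr_ge0.
move=> /allP hz.
have rz t q : (0 < t <= T)%N -> (z^T *m r t q) 0 0 = 0.
  move=> t0; have /hz : t \in index_iota 1 T.+1 by rewrite mem_index_iota ltnS.
  rewrite /= qform_sum psumr_eq0 => [|i _]; last exact: q0.
  move=> /allP/(_ q (mem_index_enum q)).
  rewrite /= qformZ qform_rank1 mulf_eq0 sqrf_eq0 gt_eqF /=; first by move=> /eqP.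
  by apply: wgt; case/andP: t0.
have rE t q : (z^T *m r t q) 0 0 = (z^T *m l q) 0 0 + t%:R * (z^T *m v) 0 0.
  by rewrite /r /relpos mulmxDr mxE -scalemxAr [X in _ + X]mxE.
(* Subtracting the equations at times 1 and 2 isolates [v]; this is where [1 < T] enters. *)
have zv : (z^T *m v) 0 0 = 0.
  have := rz 1%N (Ordinal hQ); have := rz 2%N (Ordinal hQ).
  by rewrite !rE T1 (ltnW T1) => /(_ isT) e2 /(_ isT) e1; lra.
have zl q : (z^T *m l q) 0 0 = 0.
  by have := rz 1%N q; rewrite rE zv mulr0 addr0 (ltnW T1); exact.
have zall y : y \in v :: [seq l q | q : 'I_Q] -> (z^T *m y) 0 0 = 0.
  by rewrite inE => /orP[/eqP->|/mapP[q _ ->]].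
by have := not_free_orthogonal zn0 (zall _ hu) (zall _ hu'); rewrite uf.
Qed.

(** * Linear growth of the distances and boundedness of the trace *)

Hypothesis hdist : forall q, 0 < inf [set d t q | t in [set t | (1 <= t)%N]].
Let m q := inf [set d t q | t in [set t | (1 <= t)%N]].

Lemma le_inf_dist t q : (0 < t)%N -> m q <= d t q.
Proof.
move=> t0; apply: ge_inf; last by exists t.
by exists 0 => _ [s _ <-]; rewrite sqrtr_ge0.
Qed.

Lemma dist_gt0 t q : (0 < t)%N -> 0 < d t q.
Proof. by move=> /(le_inf_dist q); apply: lt_le_trans; exact: hdist. Qed.

Lemma relpos_neq0 t q : (0 < t)%N -> r t q != 0.
Proof.
move=> /(dist_gt0 q)/gt_eqF/negbT; apply: contraNneq => r0.
by rewrite -sqrf_eq0 norm2_sqr -/(r t q) r0 !mxE expr0n addr0.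
Qed.

(** As [t v = r - l], the parallelogram law bounds the left side by [2 (d ^+ 2 + |l| ^+ 2)], and
    [m <= d] absorbs [|l|] into [(|l| / m) * d]. *)
Lemma dist_linear_growth t q : (0 < t)%N ->
  t%:R ^+ 2 * norm2 v ^+ 2 <= 2 * (1 + (norm2 (l q) / m q) ^+ 2) * d t q ^+ 2.
Proof.
move=> t0; have mq : 0 < m q := hdist q.
apply: (@le_trans _ _ (2 * (d t q ^+ 2 + norm2 (l q) ^+ 2))).
  rewrite !norm2_sqr !mxE -subr_ge0.
  set l0 := x 0 0 - _; set l1 := x 1 0 - _.
  rewrite (_ : _ - _ = (l0 + (l0 + t%:R * v 0 0)) ^+ 2
                     + (l1 + (l1 + t%:R * v 1 0)) ^+ 2); last by ring.
  by rewrite addr_ge0 ?sqr_ge0.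
rewrite -mulrA ler_pM2l // mulrDl mul1r lerD2l expr_div_n mulrAC.
rewrite ler_pdivlMr ?exprn_gt0 // ler_wpM2l ?sqr_ge0 // lerXn2r ?nnegrE //.
- exact: ltW.
- exact/ltW/dist_gt0.
- exact: le_inf_dist.
Qed.

Lemma trace_wgram_bounded : v != 0 ->
  exists C : R, forall T, \tr (wgram (fun t q => 1 / d t q ^+ 4) T) <= C.
Proof.
move=> vn0; have v0 : 0 < norm2 v ^+ 2.
  rewrite norm2_sqr lt0r addr_ge0 ?sqr_ge0 // andbT.
  apply: contra vn0; rewrite paddr_eq0 ?sqr_ge0 // !sqrf_eq0.
  by move=> /andP[/eqP e0 /eqP e1]; apply/eqP/eq_cV2; rewrite !mxE.
pose K q := 2 * (1 + (norm2 (l q) / m q) ^+ 2) / norm2 v ^+ 2.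
have K0 q : 0 <= K q by rewrite divr_ge0 ?sqr_ge0 // mulr_ge0 // addr_ge0 ?sqr_ge0.
(* Each trace term [1 / d ^+ 2] is at most [K q / t ^+ 2]; the factor 2 bounds the sum of inverse
   squares. *)
exists (2 * \sum_q K q) => T.
apply: (@le_trans _ _ (\sum_(1 <= t < T.+1) (t%:R ^+ 2)^-1 * \sum_q K q)).
  rewrite linear_sum /=; apply: ler_sum_nat => t /andP[t0 _].
  rewrite linear_sum /= mulr_sumr; apply: ler_sum => q _.
  have dq := dist_gt0 q t0.
  have d4 : d t q ^+ 4 = d t q ^+ 2 * d t q ^+ 2 by rewrite -exprD.
  have -> : \tr ((1 / d t q ^+ 4) *: (r t q *m (r t q)^T)) = (d t q ^+ 2)^-1.
    rewrite linearZ /= mxtrace_mulC trace_mx11 dot2.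
    rewrite -!expr2 -norm2_sqr -/(d t q) d4 div1r invfM.
    by rewrite mulrVK // unitfE sqrf_eq0 gt_eqF.
  have t2 : 0 < t%:R ^+ 2 :> R by rewrite exprn_gt0 ?ltr0n.
  rewrite mulrC /K !ler_pdivlMr // -mulrA [leLHS]mulrC.
  rewrite ler_pdivrMr ?exprn_gt0 //.
  exact: dist_linear_growth.
by rewrite -mulr_suml ler_wpM2r ?sumr_ge0 // sum_inv_sqr_le.
Qed.

End RelativePositions.

(** * Comparison of the bounds, strict decrease and positive limit *)

Theorem theorem1 (R : realType) (Q : nat) (hQ : (0 < Q)%N)
    (o : 'I_Q -> 'cV[R]_2) (x v : 'cV[R]_2) (alpha sigma : 'I_Q -> R)
    (hv : v != 0)
    (halpha : forall q, alpha q != 0)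
    (hsigma : forall q, 0 < sigma q)
    (hdist : forall q, 0 < inf [set dist o x v t q | t in [set t | (1 <= t)%N]]) :
  [/\ forall T : nat, (1 <= T)%N ->
        (Delta_bar o x v alpha sigma hQ T <= crlb o x v alpha sigma T)%E,
      (forall q, sigma q ^+ 2 = sigma_min2 sigma hQ /\
                 alpha q ^+ 2 = alpha_max2 alpha hQ) ->
        forall T : nat, (1 <= T)%N ->
          crlb o x v alpha sigma T = Delta_bar o x v alpha sigma hQ T
    & (exists u w : 'cV[R]_2,
         [/\ u \in v :: [seq lvec o x q | q : 'I_Q],
             w \in v :: [seq lvec o x q | q : 'I_Q]
           & free [:: u; w]]) ->
        (forall T T' : nat, (1 <= T)%N -> (T < T')%N ->
           (Delta_bar o x v alpha sigma hQ T' <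
            Delta_bar o x v alpha sigma hQ T)%E) /\
        (exists2 L : R, 0 < L &
           Delta_bar o x v alpha sigma hQ T @[T --> \oo] --> L%:E)].
Proof.
set a2 := alpha_max2 alpha hQ; set s2 := sigma_min2 sigma hQ.
have le_a2 q : alpha q ^+ 2 <= a2.
  by rewrite /a2 /alpha_max2 /maxq; exact: le_bigmax.
have s2_le q : s2 <= sigma q ^+ 2 by rewrite /s2 /sigma_min2 /minq; exact: bigmin_le.
(* The neutral element of the minimum is itself some [sigma q ^+ 2], so positivity must be, and is,
   checked for it too. *)
have s2_gt0 : 0 < s2 by apply: lt_bigmin => [|q _]; rewrite exprn_gt0.
have a2_gt0 : 0 < a2.
  apply: lt_le_trans (le_a2 (Ordinal hQ)).
  by rewrite exprn_even_gt0 //= halpha.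
have k_ge0 : 0 <= a2 / s2 by rewrite ltW ?divr_gt0.
have dpos t q : (0 < t)%N -> 0 < dist o x v t q by exact: dist_gt0.
pose w t q := a2 / s2 * (1 / dist o x v t q ^+ 4).
have DbarE T : Delta_bar o x v alpha sigma hQ T = trinv (wgram o x v w T).
  by rewrite wgramZ.
have d0 t q : 0 <= dist o x v t q by exact: sqrtr_ge0.
have w_ge0 t q : 0 <= w t q.
  by rewrite mulr_ge0 // divr_ge0 ?exprn_ge0.
have w_gt0 t q : (0 < t)%N -> 0 < w t q.
  by move=> t0; rewrite mulr_gt0 ?divr_gt0 ?exprn_gt0 ?dpos.
pose wF t q := alpha q ^+ 2 / (sigma q ^+ 2 * dist o x v t q ^+ 4).
have wFE t q : wF t q = alpha q ^+ 2 / sigma q ^+ 2 * (1 / dist o x v t q ^+ 4).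
  by rewrite /wF invfM div1r mulrA.
have wF_ge0 t q : 0 <= wF t q.
  by rewrite wFE mulr_ge0 ?divr_ge0 ?sqr_ge0 ?exprn_ge0.
have crlbE T : crlb o x v alpha sigma T = trinv (wgram o x v wF T) by [].
split=> [T _|eqas T _|indep].
(* The matrix behind [Delta_bar] is the Fisher matrix plus a positive semidefinite remainder with
   weights [wd]. *)
- pose wd t q := w t q - wF t q.
  have wd_ge0 t q : 0 <= wd t q.
    rewrite subr_ge0 wFE ler_wpM2r ?divr_ge0 ?exprn_ge0 //.
    by rewrite ler_pM ?sqr_ge0 ?invr_ge0 ?sqr_ge0 // lef_pV2 ?posrE ?exprn_gt0.
  rewrite DbarE crlbE.
  rewrite (_ : wgram o x v w T = wgram o x v wF T + wgram o x v wd T).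
    by apply: trinv_addr_psd; exact: psd_wgram.
  rewrite -wgramD; congr (wgram _ _ _ _ _).
  by apply/funext => t; apply/funext => q; rewrite /wd addrC subrK.
- rewrite DbarE crlbE; congr (trinv (wgram _ _ _ _ _)).
  apply/funext => t; apply/funext => q; rewrite wFE.
  by have [-> ->] := eqas q.
have det0 T : (1 < T)%N -> \det (wgram o x v w T) != 0.
  exact: wgram_det_neq0 w_gt0 w_ge0 indep hQ.
have anti T T' : (T <= T')%N ->
    (Delta_bar o x v alpha sigma hQ T' <= Delta_bar o x v alpha sigma hQ T)%E.
  by rewrite !DbarE; exact: trinv_wgram_anti.
split=> [T T' T1 TT'|].
  apply: le_lt_trans (anti _ _ TT') _; rewrite !DbarE.
  (* A singular matrix is possible only at [T = 1]; the value there is [+oo], while at [T.+1] it is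
     finite. *)
  have [dT|dT] := eqVneq (\det (wgram o x v w T)) 0.
    by rewrite !trinvE dT eqxx (negPf (det0 _ _)) ?ltry.
  apply: (trinv_wgram_lt (q0 := Ordinal hQ)) => //; first exact: w_gt0.
  exact: relpos_neq0.
have [C0 trC0] := trace_wgram_bounded hdist hv.
pose C := a2 / s2 * C0.
have C_ge0 : 0 <= C.
  rewrite mulr_ge0 //.
  (* The empty sum at [T = 0] has trace 0, so [C0] is nonnegative. *)
  by have := trC0 0%N; rewrite wgram0 linear0.
(* [C + 1] replaces [C], which might be 0, to have a positive bound to invert. *)
have lb T : ((C + 1)^-1%:E <= Delta_bar o x v alpha sigma hQ T)%E.
  rewrite DbarE; apply: trinv_ge; [exact: psd_wgram | exact: ltr_wpDl|].
  rewrite wgramZ linearZ /= (@le_trans _ _ C) ?lerDl //.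
  by rewrite ler_wpM2l.
(* Monotonicity holds from index 0 on, where the zero matrix gives [+oo], so the limit is the
   infimum over all indices. *)
have cv : Delta_bar o x v alpha sigma hQ T @[T --> \oo] -->
    ereal_inf (range (Delta_bar o x v alpha sigma hQ)).
  by apply: ereal_nonincreasing_cvgn => T T'; exact: anti.
set I := ereal_inf _ in cv.
have I_ge : ((C + 1)^-1%:E <= I)%E by apply: le_ereal_inf_tmp => _ [T _ <-].
have I_lt : (I < +oo)%E.
  (* Index 2 is the first at which regularity is guaranteed. *)
  apply: (@le_lt_trans _ _ (Delta_bar o x v alpha sigma hQ 2)).
    by apply: ereal_inf_lbound; exists 2%N.
  by rewrite DbarE trinvE (negPf (det0 _ _)) ?ltry.
have I_fin : I \is a fin_num.
  by rewrite fin_numE -ltey I_lt gt_eqF // (lt_le_trans _ I_ge) ?ltNyr.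
exists (fine I); last by rewrite fineK.
by rewrite -lte_fin fineK // (lt_le_trans _ I_ge) // lte_fin invr_gt0 ltr_wpDl.
Qed.
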